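(* Let $F\colon[a,b]\to\mathbb{R}$ be continuous and suppose that $LD_1F(x)$ exists and is finite for all $x\in[a,b]$ outside a countable set. Then $LD_1F$ (defined arbitrarily on the exceptional countable set) is Laplace integrable on $[a,b]$ and $\int_a^xLD_1F=F(x)-F(a)$ for all $x\in[a,b]$.
   Context: Laplace derivative: for $F$ Perron integrable near $x$, $LD_1F(x)$ is the common value, when both exist and are equal, of $\lim_{s\to\infty}s^2\int_0^\delta e^{-st}[F(x+t)-F(x)]dt$ and $\lim_{s\to\infty}(-s^2)\int_0^\delta e^{-st}[F(x-t)-F(x)]dt$ for some $\delta>0$ (independent of $\delta$; one-sided at endpoints). Lower/upper Laplace derivates $\underline{LD}_1F,\overline{LD}_1F$ are defined with $\liminf$/$\limsup$ in place of $\lim$, taking the minimum (resp. maximum) over the two sides. Laplace integral: a major function of $f\colon[a,b]\to\mathbb{R}$ is a continuous $U$ with $\underline{LD}_1U\geqslant f$ and $\underline{LD}_1U>-\infty$ everywhere on $[a,b]$; a minor function is a continuous $V$ with $\overline{LD}_1V\leqslant f$ and $\overline{LD}_1V<\infty$ everywhere; $f$ is Laplace integrable if $\sup_V(V(b)-V(a))=\inf_U(U(b)-U(a))$ is finite, this value being $\int_a^bf$. *)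

(* Defs.v *)
From HB Require Import structures.
From mathcomp Require Import all_boot all_order all_algebra.
From mathcomp Require Import all_classical all_reals all_analysis.
Set Implicit Arguments. Unset Strict Implicit. Unset Printing Implicit Defensive.
Import Order.TTheory GRing.Theory Num.Theory.
Import numFieldNormedType.Exports.
Local Open Scope classical_set_scope.
Local Open Scope ring_scope.

Section Laplace.
Variable R : realType.

Definition lap_right (F : R -> R) (x d s : R) : R :=
  s ^+ 2 * Rintegral (@lebesgue_measure R) `[0, d]
             (fun t => expR (- (s * t)) * (F (x + t) - F x)).

Definition lap_left (F : R -> R) (x d s : R) : R :=
  - s ^+ 2 * Rintegral (@lebesgue_measure R) `[0, d]
             (fun t => expR (- (s * t)) * (F (x - t) - F x)).

Definition LD1 (a b : R) (F : R -> R) (x L : R) : Prop :=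
  (x < b -> exists2 d : R, 0 < d <= b - x &
      lap_right F x d s @[s --> +oo_R] --> L) /\
  (a < x -> exists2 d : R, 0 < d <= x - a &
      lap_left F x d s @[s --> +oo_R] --> L).

Local Open Scope ereal_scope.

(* one-sided lower/upper Laplace derivates, with delta = distance to the
   endpoint (the value is independent of delta) *)
Definition low_right (b : R) (F : R -> R) (x : R) : \bar R :=
  limf_einf (fun s => (lap_right F x (b - x) s)%:E) (+oo_R)%R.
Definition low_left (a : R) (F : R -> R) (x : R) : \bar R :=
  limf_einf (fun s => (lap_left F x (x - a) s)%:E) (+oo_R)%R.
Definition up_right (b : R) (F : R -> R) (x : R) : \bar R :=
  limf_esup (fun s => (lap_right F x (b - x) s)%:E) (+oo_R)%R.
Definition up_left (a : R) (F : R -> R) (x : R) : \bar R :=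
  limf_esup (fun s => (lap_left F x (x - a) s)%:E) (+oo_R)%R.

(* lower derivate = minimum over the available sides (min over no side = +oo) *)
Definition lowLD (a b : R) (F : R -> R) (x : R) : \bar R :=
  Order.min (if (x < b)%R then low_right b F x else +oo)
            (if (a < x)%R then low_left a F x else +oo).
(* upper derivate = maximum over the available sides (max over no side = -oo) *)
Definition upLD (a b : R) (F : R -> R) (x : R) : \bar R :=
  Order.max (if (x < b)%R then up_right b F x else -oo)
            (if (a < x)%R then up_left a F x else -oo).

Definition major (a b : R) (f U : R -> R) : Prop :=
  {within `[a, b], continuous U} /\
  forall x, x \in `[a, b] -> (f x)%:E <= lowLD a b U x /\ -oo < lowLD a b U x.

Definition minor (a b : R) (f V : R -> R) : Prop :=
  {within `[a, b], continuous V} /\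
  forall x, x \in `[a, b] -> upLD a b V x <= (f x)%:E /\ upLD a b V x < +oo.

Definition laplace_integral (a b : R) (f : R -> R) (I : R) : Prop :=
  ereal_sup [set ((V b - V a)%R)%:E | V in minor a b f] = I%:E /\
  ereal_inf [set ((U b - U a)%R)%:E | U in major a b f] = I%:E.

Definition laplace_integrable (a b : R) (f : R -> R) : Prop :=
  exists I : R, laplace_integral a b f I.

End Laplace.

(* Main.v *)
(** Only values of the increment of [F] near 0 matter for the limit of its
    transform [s^2 \int_0^d e^(-st) h(t) dt], since the transform of [t^2] is at
    most [2/s]; and the transform of [t] tends to 1.

    A minor function [V] never grows more than a major function [U]: for
    [eta > 0], a maximum point [c < b] of [U - V + eta x] makes the right
    transform of its increment nonpositive, whereas the lower limit is at
    least [eta].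

    [F] itself fails to be a major function only at the exceptional points
    [e_n].  With [w] a modulus of continuity of [F], add to [F] a uniformly
    convergent sum of continuous nondecreasing functions, the [n]-th being
    [w(t) + sqrt t] at distance [t] to the right of [e_n] (the opposite to the
    left), truncated at [eps / 2^n].  This cancels the oscillation of [F] at
    [e_n] and forces the derivates there up to [+oo], at a total cost of
    [eps].  Minor functions are the opposites of major functions of [- F]. *)
Require Import Defs.
From HB Require Import structures.
From mathcomp Require Import all_boot all_order all_algebra.
From mathcomp Require Import all_classical all_reals all_analysis.
From mathcomp Require Import ring lra.
Set Implicit Arguments. Unset Strict Implicit. Unset Printing Implicit Defensive.
Import Order.TTheory GRing.Theory Num.Theory.
Import numFieldNormedType.Exports.
Local Open Scope classical_set_scope.
Local Open Scope ring_scope.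

(** * The truncated Laplace transform *)

Section LaplaceTransform.
Variable R : realType.
Implicit Types (h k : R -> R) (d s c : R).
Notation mu := (@lebesgue_measure R).

Definition lap h d s : R :=
  s ^+ 2 * Rintegral mu `[0, d] (fun t => expR (- (s * t)) * h t).

Lemma continuous_expM s : continuous (fun t : R => expR (- (s * t))).
Proof.
move=> z; apply: continuous_comp; last exact: continuous_expR.
by apply: (@continuousN _ R^o); apply: continuousM => //; exact: cst_continuous.
Qed.

Lemma integrable_continuous h (a b : R) :
  continuous h -> mu.-integrable `[a, b] (EFin \o h).
Proof.
move=> ch; apply: continuous_compact_integrable; first exact: segment_compact.
exact: continuous_subspaceT.
Qed.

Lemma lap_integrable h d s : continuous h ->
  mu.-integrable `[0, d] (EFin \o (fun t => expR (- (s * t)) * h t)).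
Proof.
move=> ch; apply: (@integrable_continuous (fun t => expR (- (s * t)) * h t)) => t.
by apply: cvgM; [exact: continuous_expM|exact: ch].
Qed.

Lemma eq_lap h k d s : {in `[0, d], h =1 k} -> lap h d s = lap k d s.
Proof.
move=> hk; congr (_ * _); apply: eq_Rintegral => t td.
by rewrite hk//; rewrite inE in td.
Qed.

Lemma lapD h k d s : continuous h -> continuous k ->
  lap (fun t => h t + k t) d s = lap h d s + lap k d s.
Proof.
move=> ch ck; rewrite /lap -mulrDr -RintegralD//; try exact: lap_integrable.
by congr (_ * _); apply: eq_Rintegral => t _; rewrite mulrDr.
Qed.

Lemma lapZ h c d s : continuous h ->
  lap (fun t => c * h t) d s = c * lap h d s.
Proof.
move=> ch; rewrite /lap [RHS]mulrCA -(@RintegralZl _ _ _ _ _ _ c)//; last exact: lap_integrable.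
by congr (_ * _); apply: eq_Rintegral => t _; rewrite mulrCA.
Qed.

Lemma lapN h d s : continuous h -> lap (fun t => - h t) d s = - lap h d s.
Proof.
move=> ch; rewrite -mulN1r -lapZ//; apply: eq_lap => t _; exact/esym/mulN1r.
Qed.

Lemma le_lap h k d s : continuous h -> continuous k ->
  (forall t, 0 <= t <= d -> h t <= k t) -> lap h d s <= lap k d s.
Proof.
move=> ch ck hk; rewrite /lap ler_wpM2l// ?sqr_ge0//.
apply: le_Rintegral => //; try exact: lap_integrable.
by move=> t; rewrite /= in_itv/= => td; rewrite ler_wpM2l ?expR_ge0// hk.
Qed.

Lemma Rintegral_FTC2 (f F : R -> R) (d : R) : 0 < d -> continuous f ->
  (forall x : R, is_derive x 1 F (f x)) ->
  Rintegral mu `[0, d] f = F d - F 0.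
Proof.
move=> d0 cf dF; rewrite /Rintegral (@continuous_FTC2 _ f F)//.
- exact: continuous_subspaceT.
- have cF x : {for x, continuous F}.
    exact/differentiable_continuous/derivable1_diffP/(@ex_derive _ _ _ _ _ _ _ (dF x)).
  split.
  + by move=> z _; exact: (@ex_derive _ _ _ _ _ _ _ (dF z)).
  + by apply/cvg_at_right_filter; exact: cF.
  + by apply/cvg_at_left_filter; exact: cF.
- by move=> z _; rewrite derive1E (@derive_val _ _ _ _ _ _ _ (dF z)).
Qed.

Lemma lap_id d s : 0 < d -> 0 < s ->
  lap id d s = 1 - (s * d + 1) * expR (- (s * d)).
Proof.
move=> d0 s0; have sn0 : s != 0 by rewrite gt_eqF.
have dF (x : R) : is_derive x 1
    (fun t => - (t / s + s ^- 2) * expR (- (s * t))) (expR (- (s * x)) * x).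
  by apply: is_derive_eq; rewrite /GRing.scale/=; field.
rewrite /lap (Rintegral_FTC2 d0 _ dF)/=.
- by rewrite mulr0 oppr0 expR0; field.
- by move=> t; apply: cvgM; [exact: continuous_expM|exact: cvg_id].
Qed.

Lemma lap_sq_le d s : 0 < d -> 0 < s -> lap (fun t => t ^+ 2) d s <= 2 / s.
Proof.
move=> d0 s0; have sn0 : s != 0 by rewrite gt_eqF.
have dF (x : R) : is_derive x 1
    (fun t => - (t ^+ 2 / s + 2 * t / s ^+ 2 + 2 / s ^+ 3) * expR (- (s * t)))
    (expR (- (s * x)) * x ^+ 2).
  by apply: is_derive_eq; rewrite /GRing.scale/=; field.
rewrite /lap (Rintegral_FTC2 d0 _ dF)/=.
(* The primitive at 0 contributes exactly [2 / s]; what is missing is the boundary term at [d],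
   visibly nonnegative. *)
- rewrite !mulr0 oppr0 expR0 -subr_ge0 [leRHS](_ : _ =
     (d ^+ 2 * s + 2 * d  + 2 / s) * expR (- (s * d))); last by field.
  by rewrite mulr_ge0 ?expR_ge0// !addr_ge0 ?mulr_ge0 ?sqr_ge0 ?invr_ge0 ?ltW.
- move=> t; apply: cvgM; [exact: continuous_expM|exact: exprn_continuous].
Qed.
End LaplaceTransform.

(** * Behaviour of the transform as [s] tends to infinity *)

Section LaplaceAsymptotics.
Variable R : realType.
Implicit Types (h k : R -> R) (d e eps s c C : R).
Notation mu := (@lebesgue_measure R).

Lemma near_div_pinfty c e : 0 < e -> \forall s \near +oo_R, c / s <= e.
Proof.
move=> e0; near=> s.
have s0 : 0 < s by near: s; exact: nbhs_pinfty_gt.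
by rewrite ler_pdivrMr// -ler_pdivrMl//.
Unshelve. all: by end_near. Qed.

(** Beyond [e] the factor [t ^+ 2 / e ^+ 2] is at least 1, so it may multiply the absolute value of
    the maximum of [h]; up to [e] the sign of [h] suffices. *)
Lemma quadratic_bound h d e : continuous h -> 0 < e <= d ->
  (forall t, 0 <= t <= e -> h t <= 0) ->
  exists2 C, 0 <= C & forall t, 0 <= t <= d -> h t <= C * t ^+ 2.
Proof.
move=> ch /andP[e0 ed] h0.
have [|c _ hc] := @EVT_max R h 0 d (le_trans (ltW e0) ed).
  exact: continuous_subspaceT.
exists (`|h c| / e ^+ 2); first by rewrite divr_ge0 ?sqr_ge0.
move=> t /andP[t0 td]; have [te|et] := leP t e.
  apply: (le_trans (h0 _ _)); first by rewrite t0.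
  by rewrite mulr_ge0 ?sqr_ge0// divr_ge0 ?sqr_ge0.
apply: (@le_trans _ _ `|h c|).
  by rewrite (le_trans _ (ler_norm _))// hc// in_itv/= t0.
rewrite mulrAC ler_pdivlMr ?exprn_gt0// ler_wpM2l//.
by rewrite lerXn2r ?nnegrE// ?(ltW e0)// ltW.
Qed.

Lemma continuous_scale_sq C : continuous (fun t : R => C * t ^+ 2).
Proof.
by move=> t; apply: cvgM; [exact: cvg_cst|exact: exprn_continuous].
Qed.

(* Nonpositive near 0, [h] is dominated on [0, d] by a multiple of [t ^+ 2]. *)
Lemma lap_le_near h d e eps : continuous h -> 0 < e <= d ->
  (forall t, 0 <= t <= e -> h t <= 0) -> 0 < eps ->
  \forall s \near +oo_R, lap h d s <= eps.
Proof.
move=> ch ed h0 eps0; have [C C0 hC] := quadratic_bound ch ed h0.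
have d0 : 0 < d by case/andP: ed => e0; exact: lt_le_trans.
near=> s.
have s0 : 0 < s by near: s; exact: nbhs_pinfty_gt.
apply: (le_trans (le_lap s ch (@continuous_scale_sq C) hC)).
rewrite lapZ; last exact: exprn_continuous.
apply: (le_trans (ler_wpM2l C0 (lap_sq_le d0 s0))).
by rewrite mulrA; near: s; exact: near_div_pinfty.
Unshelve. all: by end_near. Qed.

Lemma le_lap_near h k d e eps : continuous h -> continuous k -> 0 < e <= d ->
  (forall t, 0 <= t <= e -> h t <= k t) -> 0 < eps ->
  \forall s \near +oo_R, lap h d s <= lap k d s + eps.
Proof.
move=> ch ck ed hk eps0.
have cNk : continuous (fun t => - k t) by move=> t; apply: cvgN; exact: ck.
have chk : continuous (fun t => h t + - k t).
  by move=> t; apply: cvgD; [exact: ch|exact: cNk].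
have hk0 t : 0 <= t <= e -> h t + - k t <= 0.
  by move=> te; rewrite subr_le0 hk.
apply: filterS (lap_le_near chk ed hk0 eps0) => s.
by rewrite lapD// lapN// lerBlDl.
Qed.

Lemma lap_id_ge_near d eps : 0 < d -> 0 < eps ->
  \forall s \near +oo_R, 1 - eps <= lap id d s.
Proof.
move=> d0 eps0; near=> s.
have s0 : 0 < s by near: s; exact: nbhs_pinfty_gt.
have sd0 : 0 < s * d by rewrite mulr_gt0.
rewrite lap_id// lerD2l lerN2.
(* With [y = s d / 2], the exponential [e^(2y)] is at least [(1 + y)^2], a quadratic that beats
   [2y + 1] by the factor [1 / eps] once [y >= 2 / eps]. *)
have -> : s * d = s * d / 2 + s * d / 2 by field.
set y := s * d / 2; have y0 : 0 < y by rewrite divr_gt0.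
rewrite opprD expRD expRN -invfM ler_pdivrMr ?mulr_gt0 ?expR_gt0//.
have ye := expR_ge1Dx y.
have ey : 2 / eps <= y.
  by rewrite /y ler_pdivlMr// -ler_pdivrMr//.
rewrite (@le_trans _ _ (eps * ((1 + y) * (1 + y))))//; last first.
  by apply: ler_wpM2l; [exact: ltW|apply: ler_pM => //; lra].
rewrite ler_pdivrMr// in ey; nra.
Unshelve. all: by end_near. Qed.

(** On []e, d]] the function [|h|] is at most [C t^2], so the difference is dominated by the
    transform of [C t^2], which is at most [2 C / s]. This is the independence of the derivative
    from the cut-off. *)
Lemma cvg_lap_trunc h d e : continuous h -> 0 < e <= d ->
  lap h d s - lap h e s @[s --> +oo_R] --> (0 : R).
Proof.
move=> ch /andP[e0 ed]; have d0 := lt_le_trans e0 ed.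
have [|c _ hc] := @EVT_max R (fun t => `|h t|) 0 d (ltW d0).
  by apply: continuous_subspaceT => t; apply: cvg_norm; exact: ch.
pose C := `|h c| / e ^+ 2; have C0 : 0 <= C by rewrite divr_ge0 ?sqr_ge0.
have hC t : t \in `]e, d] -> `|h t| <= C * t ^+ 2.
  rewrite in_itv/= => /andP[et td].
  apply: (@le_trans _ _ `|h c|).
    by rewrite hc// in_itv/= td (ltW (lt_trans e0 et)).
  rewrite mulrAC ler_pdivlMr ?exprn_gt0// ler_wpM2l//.
  by rewrite lerXn2r ?nnegrE ?(ltW e0)// ltW// (lt_trans e0 et).
have tail k s : continuous k -> lap k d s - lap k e s =
    s ^+ 2 * Rintegral mu `]e, d] (fun t => expR (- (s * t)) * k t).
  move=> ck; rewrite /lap -mulrBr Rintegral_itvB ?bnd_simp ?(ltW e0)//.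
  exact: lap_integrable.
have itail k s : continuous k ->
    mu.-integrable `]e, d] (EFin \o (fun t => expR (- (s * t)) * k t)).
  move=> ck; apply: integrableS (lap_integrable d s ck) => //.
  by apply: subset_itvr; rewrite bnd_simp ltW.
have cC := @continuous_scale_sq C.
have cn : continuous (fun t => `|h t|) by move=> t; apply: cvg_norm; exact: ch.
apply/cvgrPdist_le => eps eps0; near=> s.
have s0 : 0 < s by near: s; exact: nbhs_pinfty_gt.
rewrite sub0r normrN tail// normrM ger0_norm ?sqr_ge0//.
apply: (@le_trans _ _ (lap (fun t => C * t ^+ 2) d s)); last first.
  rewrite lapZ; last exact: exprn_continuous.
  apply: (le_trans (ler_wpM2l C0 (lap_sq_le d0 s0))).
  by rewrite mulrA; near: s; exact: near_div_pinfty.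
apply: (@le_trans _ _ (lap (fun t => C * t ^+ 2) d s -
                       lap (fun t => C * t ^+ 2) e s)); last first.
  rewrite gerBl mulr_ge0 ?sqr_ge0// Rintegral_ge0// => t _.
  by rewrite mulr_ge0 ?expR_ge0// mulr_ge0 ?sqr_ge0.
rewrite tail// ler_wpM2l ?sqr_ge0//.
apply: (le_trans (le_normr_Rintegral _ (itail _ _ ch))) => //.
under eq_Rintegral do rewrite normrM ger0_norm ?expR_ge0//.
apply: le_Rintegral => //; try exact: itail.
by move=> t et; apply: ler_wpM2l; [exact: expR_ge0|exact: hC].
Unshelve. all: by end_near. Qed.
End LaplaceAsymptotics.

(** * Laplace derivates *)

Section LaplaceDerivates.
Variable R : realType.
Implicit Types (F U V f g h : R -> R) (a b c x y d e s eps : R).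

(** Trades the extended-real lower limit for eventual real inequalities, which transforms of
    comparable increments inherit. *)
Lemma le_limf_einfP g c :
  (c%:E <= limf_einf (fun s => (g s)%:E) +oo_R)%E <->
  (forall eps, 0 < eps -> \forall s \near +oo_R, c - eps <= g s).
Proof.
rewrite limf_einfE; split=> [cg eps eps0|cg].
  have /ereal_sup_gt[_ [A FA <-] cA] : ((c - eps)%:E <
      ereal_sup [set ereal_inf ((fun s => (g s)%:E) @` A) | A in +oo_R])%E.
    by apply: lt_le_trans cg; rewrite lte_fin gtrBl.
  apply: filterS FA => s As; rewrite -lee_fin (le_trans (ltW cA))//.
  by apply: ereal_inf_lbound; exists s.
apply/lee_addgt0Pr => eps eps0; rewrite -leeBlDr// -EFinB.
apply: ereal_sup_ge; eexists.
  by exists [set s | c - eps <= g s]; [exact: cg|reflexivity].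
by apply: le_ereal_inf_tmp => _ [s /= cgs <-]; rewrite lee_fin.
Qed.

Definition rincr F x t := F (x + t) - F x.
(** The sign absorbs the minus of the left transform: both sides become [lap] of an increment that
    is nonnegative for nondecreasing [F]. *)
Definition lincr F x t := F x - F (x - t).

Lemma continuous_rincr F x : continuous F -> continuous (rincr F x).
Proof.
move=> cF t; apply: cvgB; last exact: cvg_cst.
apply: (@continuous_comp _ _ _ (fun t => x + t) F); last exact: cF.
by apply: cvgD; [exact: cvg_cst|exact: cvg_id].
Qed.

Lemma continuous_lincr F x : continuous F -> continuous (lincr F x).
Proof.
move=> cF t; apply: cvgB; first exact: cvg_cst.
apply: (@continuous_comp _ _ _ (fun t => x - t) F); last exact: cF.
by apply: cvgB; [exact: cvg_cst|exact: cvg_id].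
Qed.

Lemma lap_leftE F x d s : continuous F ->
  lap_left F x d s = lap (lincr F x) d s.
Proof.
move=> cF; rewrite -[RHS]opprK -lapN; last exact: continuous_lincr.
rewrite /lap_left /lap mulNr; congr (- (_ * _)).
by apply: eq_Rintegral => t _; rewrite /lincr opprB.
Qed.

(** Real-valued form of [c <= lowLD a b F x] for continuous [F]; a side missing at an endpoint is
    vacuous, matching the default [+oo] there. *)
Definition derivate_ge a b F x c :=
  (x < b -> forall eps, 0 < eps ->
     \forall s \near +oo_R, c - eps <= lap (rincr F x) (b - x) s) /\
  (a < x -> forall eps, 0 < eps ->
     \forall s \near +oo_R, c - eps <= lap (lincr F x) (x - a) s).

Lemma le_lowLDP a b U x c : continuous U ->
  (c%:E <= lowLD a b U x)%E <-> derivate_ge a b U x c.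
Proof.
move=> cU; rewrite /lowLD le_min /low_right /low_left.
have -> : (fun s => (lap_left U x (x - a) s)%:E) =
    (fun s => (lap (lincr U x) (x - a) s)%:E).
  by apply/funext => s; rewrite lap_leftE.
split=> [/andP[rU lU]|[rU lU]].
  split=> [xb|ax]; first by apply/le_limf_einfP; move: rU; rewrite xb.
  by apply/le_limf_einfP; move: lU; rewrite ax.
apply/andP; split; case: ifPn => [|_]; rewrite ?leey//.
  by move=> xb; apply/le_limf_einfP; exact: rU.
by move=> ax; apply/le_limf_einfP; exact: lU.
Qed.

Lemma lap_rightN F x d s : continuous F ->
  lap_right (\- F) x d s = - lap_right F x d s.
Proof.
move=> cF; rewrite -lapN; last exact: continuous_rincr.
by apply: eq_lap => t _; rewrite /rincr opprB addrC opprK.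
Qed.

Lemma lap_leftN F x d s : continuous F ->
  lap_left (\- F) x d s = - lap_left F x d s.
Proof.
move=> cF; have cNF : continuous (\- F) by move=> z; apply: cvgN; exact: cF.
rewrite !lap_leftE// -lapN; last exact: continuous_lincr.
by apply: eq_lap => t _; rewrite /lincr opprB addrC opprK.
Qed.

Lemma upLDN a b V x : continuous V ->
  upLD a b V x = (- lowLD a b (\- V)%R x)%E.
Proof.
move=> cV; rewrite /upLD /lowLD /low_right /low_left /up_right /up_left.
rewrite (_ : (fun s => (lap_right (\- V) x (b - x) s)%:E) =
  (\- (fun s => (lap_right V x (b - x) s)%:E))%E); last first.
  by apply/funext => s; rewrite lap_rightN.
rewrite (_ : (fun s => (lap_left (\- V) x (x - a) s)%:E) =
  (\- (fun s => (lap_left V x (x - a) s)%:E))%E); last first.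
  by apply/funext => s; rewrite lap_leftN.
rewrite !limf_einfN oppe_min; congr Order.max; by case: ifP => //; rewrite oppeK.
Qed.

Lemma majorP a b f U : continuous U ->
  major a b f U <-> forall x, x \in `[a, b] -> derivate_ge a b U x (f x).
Proof.
move=> cU; split=> [[_ mU] x xab|mU].
  by apply/le_lowLDP => //; case: (mU x xab).
split=> [|x xab]; first exact: continuous_subspaceT.
have fU : ((f x)%:E <= lowLD a b U x)%E by apply/le_lowLDP => //; exact: mU.
by split=> //; apply: lt_le_trans fU; exact: ltNyr.
Qed.

Lemma minorP a b f V : continuous V ->
  minor a b f V <->
  forall x, x \in `[a, b] -> derivate_ge a b (\- V) x (- f x).
Proof.
move=> cV; have cNV : continuous (\- V) by move=> z; apply: cvgN; exact: cV.
split=> [[_ mV] x xab|mV].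
  apply/le_lowLDP => //; case: (mV x xab) => + _.
  by rewrite upLDN// EFinN leeNl.
split=> [|x xab]; first exact: continuous_subspaceT.
have fV : (upLD a b V x <= (f x)%:E)%E.
  by rewrite upLDN// leeNl -EFinN; apply/le_lowLDP => //; exact: mV.
by split=> //; apply: le_lt_trans fV _; exact: ltry.
Qed.

(** With the distance to the endpoint as cut-off, the transforms only read values on [[a, b]]. Hence
    functions continuous on the interval can be replaced by globally continuous extensions. *)
Lemma eq_LD a b F G x : x \in `[a, b] -> {in `[a, b], F =1 G} ->
  lowLD a b F x = lowLD a b G x /\ upLD a b F x = upLD a b G x.
Proof.
move=> xab FG.
have rE s : lap_right F x (b - x) s = lap_right G x (b - x) s.
  apply: eq_lap => t; move: (xab); rewrite !in_itv/= => xab' tb.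
  by rewrite !FG// ?in_itv/=; lra.
have lE s : lap_left F x (x - a) s = lap_left G x (x - a) s.
  congr (_ * _); apply: eq_Rintegral => t; rewrite inE/=.
  move: (xab); rewrite !in_itv/= => xab' tb.
  by rewrite !FG// ?in_itv/=; lra.
rewrite /lowLD /upLD /low_right /low_left /up_right /up_left.
have -> : lap_right F x (b - x) = lap_right G x (b - x) by apply/funext.
by have -> : lap_left F x (x - a) = lap_left G x (x - a) by apply/funext.
Qed.

Lemma eq_LD1 a b F G x c : x \in `[a, b] -> {in `[a, b], F =1 G} ->
  LD1 a b F x c -> LD1 a b G x c.
Proof.
move=> xab FG [rF lF]; split=> [/rF|/lF] [d /andP[d0 dx] Fd];
  (exists d; first by rewrite d0).
- suff -> : lap_right G x d = lap_right F x d by [].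
  apply/funext => s; apply: eq_lap => t.
  move: (xab); rewrite !in_itv/= => xab' tb.
  by rewrite !FG// ?in_itv/=; lra.
- suff -> : lap_left G x d = lap_left F x d by [].
  apply/funext => s; congr (_ * _); apply: eq_Rintegral => t; rewrite inE/=.
  move: (xab); rewrite !in_itv/= => xab' tb.
  by rewrite !FG// ?in_itv/=; lra.
Qed.

Lemma cvg_lap_indep h c d e : continuous h -> 0 < d -> 0 < e ->
  lap h d s @[s --> +oo_R] --> c -> lap h e s @[s --> +oo_R] --> c.
Proof.
move=> ch d0 e0 hd; have [ed|de] := leP e d.
  have -> : lap h e = fun s => lap h d s - (lap h d s - lap h e s).
    by apply/funext => s; rewrite opprB addrC subrK.
  rewrite -[c]subr0; apply: cvgB => //; apply: cvg_lap_trunc => //.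
  by rewrite e0.
have -> : lap h e = fun s => lap h d s + (lap h e s - lap h d s).
  by apply/funext => s; rewrite addrC subrK.
rewrite -[c]addr0; apply: cvgD => //; apply: cvg_lap_trunc => //.
by rewrite d0 ltW.
Qed.

Lemma cvg_ge_near h c eps : h s @[s --> +oo_R] --> c -> 0 < eps ->
  \forall s \near +oo_R, c - eps <= h s.
Proof.
move=> /cvgrPdist_le hc eps0; apply: filterS (hc _ eps0) => s.
by rewrite ler_norml => /andP[_]; rewrite lerBlDr lerBlDl.
Qed.

(** Changing the cut-off does not change the limit, so the right end may be lowered to [y]. This
    serves integrals up to intermediate points of [[a, b]]. *)
Lemma LD1_derivate_ge a b y F x c : continuous F -> y <= b ->
  LD1 a b F x c -> derivate_ge a y F x c.
Proof.
move=> cF yb [rF lF]; split=> [xy|ax] eps eps0.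
  have [d /andP[d0 _] Fd] := rF (lt_le_trans xy yb).
  apply: cvg_ge_near => //; apply: cvg_lap_indep Fd => //.
    exact: continuous_rincr.
  by rewrite subr_gt0.
have [d /andP[d0 _]] := lF ax.
rewrite (_ : lap_left F x d = lap (lincr F x) d); last first.
  by apply/funext => s; rewrite lap_leftE.
move=> Fd; apply: cvg_ge_near => //; apply: cvg_lap_indep Fd => //.
  exact: continuous_lincr.
by rewrite subr_gt0.
Qed.

Lemma LD1N a b F x c : continuous F -> LD1 a b F x c ->
  LD1 a b (\- F) x (- c).
Proof.
move=> cF [rF lF]; have cNF : continuous (\- F) by move=> z; apply: cvgN; exact: cF.
split=> [/rF|/lF] [d dx Fd]; exists d => //.
- suff -> : lap_right (\- F) x d = fun s => - lap_right F x d s by exact: cvgN.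
  by apply/funext => s; rewrite lap_rightN.
- suff -> : lap_left (\- F) x d = fun s => - lap_left F x d s by exact: cvgN.
  by apply/funext => s; rewrite lap_leftN.
Qed.
End LaplaceDerivates.

(** * Comparison of minor and major functions *)

Section MonotoneComparison.
Variable R : realType.
Implicit Types (F U V f g h : R -> R) (a b c x y d e s eps : R).

Lemma derivate_ge_incr_le a b f U V : a <= b -> continuous U -> continuous V ->
  (forall x, x \in `[a, b] -> derivate_ge a b U x (f x)) ->
  (forall x, x \in `[a, b] -> derivate_ge a b (\- V) x (- f x)) ->
  V b - V a <= U b - U a.
Proof.
move=> ab cU cV mU mV.
have cNV : continuous (\- V) by move=> z; apply: cvgN; exact: cV.
(* Below, [eta = eps / (b - a + 1)]; the added 1 keeps the division valid when [a = b]. *)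
suff H eta : 0 < eta -> V b - V a <= U b - U a + eta * (b - a).
  apply/ler_addgt0Pr => eps eps0; have ba1 : 0 < b - a + 1 by lra.
  apply: (le_trans (H _ (divr_gt0 eps0 ba1))).
  by rewrite lerD2l -mulrAC ler_pdivrMr// ler_wpM2l ?ltW//; lra.
move=> eta0; pose P x := U x - V x + eta * x.
have cP : continuous P.
  move=> x; apply: cvgD; first by apply: cvgB; [exact: cU|exact: cV].
  by apply: cvgM; [exact: cvg_cst|exact: cvg_id].
have [c cab cmax] := EVT_max ab (continuous_subspaceT cP).
(* A maximum of [P] at [b] gives [P a <= P b], which is the desired inequality. *)
suff cb : c = b.
  have := cmax a; rewrite cb /P in_itv/= lexx ab => /(_ isT).
  by rewrite mulrBr; lra.
apply/eqP; move: (cab); rewrite in_itv/= => /andP[ac]; rewrite le_eqVlt.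
case/orP=> // cltb; exfalso.
have d0 : 0 < b - c by rewrite subr_gt0.
(* At a common [s], the transforms for [U] and [- V] lose [eta / 8] each while [f c] cancels, and
   the linear term brings at least [eta / 2]: the total is at least [eta / 4]. *)
have e0 : 0 < eta / 8 by lra.
have [+ _] := mU c cab; move=> /(_ cltb _ e0) Un.
have [+ _] := mV c cab; move=> /(_ cltb _ e0) Vn.
have h2 : 0 < 1 / 2 :> R by lra.
have In := lap_id_ge_near d0 h2.
have [s [[Us Vs] Is]] := filter_ex (filterI (filterI Un Vn) In).
have ci : continuous (fun t : R => eta * t).
  by move=> t; apply: cvgM; [exact: cvg_cst|exact: cvg_id].
have cUi := @continuous_rincr _ U c cU.
have cVi := @continuous_rincr _ (\- V) c cNV.
have cUV : continuous (fun t => rincr U c t + rincr (\- V) c t).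
  by move=> t; apply: cvgD; [exact: cUi|exact: cVi].
(* The integrand is the increment of [P] from its maximum point, hence nonpositive; zero is written
   [0 * id t] so that [lapZ] evaluates its transform. *)
have : lap (fun t => (rincr U c t + rincr (\- V) c t) + eta * t) (b - c) s
    <= lap (fun t => 0 * id t) (b - c) s.
  apply: le_lap; first by move=> t; apply: cvgD; [exact: cUV|exact: ci].
    by move=> t; apply: cvgM; [exact: cvg_cst|exact: cvg_id].
  move=> t /andP[t0 tb]; have ctab : c + t \in `[a, b].
    by rewrite in_itv/=; lra.
  have := cmax _ ctab; rewrite mul0r /P /rincr mulrDr /=; lra.
have cid : continuous (@id R) by move=> t; exact: cvg_id.
rewrite lapD// lapD// !(@lapZ _ id)// mul0r.
have : eta * (1 / 2) <= eta * lap id (b - c) s by apply: ler_wpM2l; [exact: ltW|lra].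
lra.
Qed.
End MonotoneComparison.

(** * Uniformly continuous extensions and moduli of continuity *)

Section ContinuousFunctions.
Variable R : realType.
Implicit Types (F G f g h : R -> R) (a b c x y d e s t eps : R).

Definition clamp a b x := Num.max a (Num.min b x).

Lemma clamp_in a b x : a <= b -> clamp a b x \in `[a, b].
Proof.
by move=> ab; rewrite /clamp in_itv/= maxEle minEle; do !case: ifP; lra.
Qed.

Lemma clamp_id a b x : x \in `[a, b] -> clamp a b x = x.
Proof.
by rewrite /clamp in_itv/= => xab; rewrite maxEle minEle; do !case: ifP; lra.
Qed.

Lemma clamp_mono a b x y : x <= y -> clamp a b x <= clamp a b y.
Proof. by move=> xy; rewrite /clamp !maxEle !minEle; do !case: ifP; lra. Qed.

Lemma clamp_contr a b x y : a <= b -> `|clamp a b x - clamp a b y| <= `|x - y|.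
Proof.
move=> ab; wlog xy : x y / x <= y.
  move=> H; have [|/ltW] := leP x y; first exact: H.
  by rewrite distrC (distrC x); exact: H.
rewrite !ler0_norm ?subr_le0 ?clamp_mono//.
by rewrite /clamp !maxEle !minEle; do !case: ifP; lra.
Qed.

Lemma heine F a b : {within `[a, b], continuous F} -> forall eps, 0 < eps ->
  exists2 d, 0 < d & forall x y, x \in `[a, b] -> y \in `[a, b] ->
    `|x - y| < d -> `|F x - F y| <= eps.
Proof.
move=> /subspace_continuousP cF eps eps0.
have /compact_near_coveringP nc := @segment_compact R a b.
(* Near each [x], both [x'] and the scale [d] vary; compactness then yields one [d] valid for all
   [x']. *)
have /nc : forall x, `[a, b]%classic x -> \forall x' \near x & d \near (0:R)^'+,
    x' \in `[a, b] -> forall y, y \in `[a, b] -> `|x' - y| < d ->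
    `|F x' - F y| <= eps.
  move=> x xab; have e20 : 0 < eps / 2 by lra.
  have /cvgrPdist_lt/(_ _ e20) := cF x xab.
  rewrite /prop_near1 /within/= => /nbhs_ballP[r /= r0 rF].
  near=> x' d => /= x'ab y yab x'y.
  have x'r : `|x - x'| < r / 2.
    by near: x'; apply: nbhsx_ballx; rewrite divr_gt0.
  have dr : d < r / 2 by near: d; apply: nbhs_right_lt; rewrite divr_gt0.
  have Fx' : `|F x - F x'| < eps / 2 by apply: rF => //; rewrite -ball_normE/=; lra.
  have Fy : `|F x - F y| < eps / 2.
    apply: rF => //; rewrite -ball_normE/= -(subrKA x').
    by rewrite (le_lt_trans (ler_normD _ _))//; lra.
  rewrite -(subrKA (F x)) (le_trans (ler_normD _ _))// (distrC (F x')); lra.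
move=> H; have [d [Hd d0]] := filter_ex (filterI H (nbhs_right_gt 0)).
by exists d => // x y xab yab; exact: Hd.
Unshelve. all: by end_near. Qed.

Definition unif_cont F := forall eps, 0 < eps ->
  exists2 d, 0 < d & forall x y, `|x - y| < d -> `|F x - F y| <= eps.

Lemma unif_cont_continuous F : unif_cont F -> continuous F.
Proof.
move=> uF x; apply/cvgrPdist_le => eps /uF[d d0 dF];
by exists d => // y; exact: dF.
Qed.

(** Composing with the 1-Lipschitz [clamp] extends [F] by its end values; Heine's theorem and
    boundedness on [[a, b]] carry over to the line. *)
Lemma continuous_itv_extension F a b : a <= b ->
  {within `[a, b], continuous F} ->
  exists G, [/\ {in `[a, b], F =1 G}, unif_cont G &
    exists M, forall x, `|G x| <= M].
Proof.
move=> ab cF; pose G x := F (clamp a b x).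
have FG : {in `[a, b], F =1 G} by move=> x xab; rewrite /G clamp_id.
have uG : unif_cont G.
  move=> eps /(heine cF)[d d0 dF]; exists d => // x y xy.
  by apply: dF; rewrite ?clamp_in// (le_lt_trans (clamp_contr _ _ ab)).
exists G; split => //.
have cG := unif_cont_continuous uG.
have [c _ cmax] := @EVT_max R (fun t => `|G t|) a b ab
  (continuous_subspaceT (fun t => cvg_norm (cG t))).
exists `|G c| => x; rewrite (_ : G x = G (clamp a b x)); last first.
  by rewrite /G (clamp_id (clamp_in x ab)).
exact/cmax/clamp_in.
Qed.

(** * Modulus of continuity of a bounded uniformly continuous function *)

Section modulus.
Variables (G : R -> R) (M : R).
Hypotheses (uG : unif_cont G) (GM : forall x, `|G x| <= M).

Let A t := [set `|G z.1 - G z.2| | z in [set z : R * R | `|z.1 - z.2| <= `|t|]].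
Let w t := sup (A t).

Let A_sup t : has_sup (A t).
Proof.
split; first by exists `|G 0 - G 0|; exists (0, 0) => //=; rewrite subrr normr0.
exists (M + M) => _ [[x y] /= _ <-].
by rewrite (le_trans (ler_normB _ _))// lerD.
Qed.

Let w_ub t x y : `|x - y| <= `|t| -> `|G x - G y| <= w t.
Proof. by move=> xy; apply: sup_upper_bound; [exact: A_sup|exists (x, y)]. Qed.

Let w_le t c : (forall x y, `|x - y| <= `|t| -> `|G x - G y| <= c) -> w t <= c.
Proof.
move=> H; apply: ge_sup; first by case: (A_sup t).
by move=> _ [[x y] /= xy <-]; exact: H.
Qed.

Let w_mono s t : `|s| <= `|t| -> w s <= w t.
Proof. by move=> st; apply: w_le => x y xy; apply: w_ub; exact: le_trans st. Qed.

Let w_subadd s t c : `|c| <= `|s| + `|t| -> w c <= w s + w t.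
Proof.
move=> cst; apply: w_le => x y xy; have {xy cst} := le_trans xy cst.
have H x1 y1 : x1 <= y1 -> `|x1 - y1| <= `|s| + `|t| ->
    `|G x1 - G y1| <= w s + w t.
  move=> xy; rewrite ler0_norm ?subr_le0// => yx.
  (* This point splits the step from [x1] to [y1] into one of length at most [|s|] and one of length
     at most [|t|]. *)
  pose z := Num.min y1 (x1 + `|s|).
  rewrite -(subrKA (G z)) (le_trans (ler_normD _ _))// lerD// w_ub//.
    rewrite ler_norml; have := normr_ge0 s.
    by rewrite /z minEle; case: ifP; lra.
  rewrite ler_norml; have := normr_ge0 s; have := normr_ge0 t.
  by rewrite /z minEle; case: ifP; lra.
have [|/ltW] := leP x y; first exact: H.
by rewrite distrC (distrC (G x)); exact: H.
Qed.

Let w_small eps : 0 < eps -> exists2 d, 0 < d & forall t, `|t| < d -> w t <= eps.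
Proof.
move=> /uG[d d0 dG]; exists d => // t td; apply: w_le => x y xy.
by apply: dG; exact: le_lt_trans td.
Qed.

Lemma modulus : exists w0 : R -> R, [/\ continuous w0, w0 0 = 0,
  forall s t, 0 <= s <= t -> w0 s <= w0 t &
  forall x y, `|G x - G y| <= w0 `|x - y|].
Proof.
exists w; split.
- move=> t; apply/cvgrPdist_le => eps /w_small[d d0 dw];
  exists d => // u /dw wtu.
  (* Subadditivity bounds [|w t - w u|] by [w (t - u)], so continuity everywhere reduces to
     smallness near 0. *)
  have h1 : w t <= w u + w (t - u).
    by apply: w_subadd; rewrite -{1}(subrK u t) addrC ler_normD.
  have h2 : w u <= w t + w (t - u).
    apply: w_subadd; rewrite -{1}(subrK t u) addrC (le_trans (ler_normD _ _))//.
    by rewrite (distrC u).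
  by rewrite ler_norml; lra.
- apply/eqP; rewrite eq_le; apply/andP; split; last first.
    by have := @w_ub 0 0 0; rewrite !subrr normr0; apply.
  apply: w_le => x y; rewrite normr0 normr_le0 subr_eq0 => /eqP ->.
  by rewrite subrr normr0.
- by move=> s t /andP[s0 st]; apply: w_mono; rewrite !ger0_norm ?(le_trans s0).
- by move=> x y; apply: w_ub; rewrite normr_id.
Qed.

End modulus.
End ContinuousFunctions.

(** * Major functions close to the primitive *)

Section IncreasingPerturbation.
Variable R : realType.
Implicit Types (F G f g h : R -> R) (a b c x y d e s t eps : R).

Lemma clamp_continuous a b : a <= b -> continuous (clamp a b).
Proof.
move=> ab; apply: unif_cont_continuous => eps eps0; exists eps => // x y xy.
exact: le_trans (clamp_contr x y ab) (ltW xy).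
Qed.

(* The perturbation rises near [e] faster than [G] can oscillate, by more than
   any linear function, thanks to the square root. *)
Lemma bump G (w : R -> R) e c : continuous w -> w 0 = 0 ->
  (forall s t, 0 <= s <= t -> w s <= w t) ->
  (forall x y, `|G x - G y| <= w `|x - y|) -> 0 < c ->
  exists g, [/\ continuous g, {homo g : x y / x <= y},
    forall x, `|g x| <= c &
    forall K, exists2 d, 0 < d & forall t, 0 <= t <= d ->
      K * t <= rincr G e t + rincr g e t /\
      K * t <= lincr G e t + lincr g e t].
Proof.
move=> cw w0 wm wG c0; have c0' := ltW c0; have cc : - c <= c by lra.
pose p t := w (Num.max 0 t) + Num.sqrt (Num.max 0 t).
(* Since [p] vanishes on the negative half-line, [chi] is the odd extension of [w t + sqrt t]. *)
pose chi t := p t - p (- t).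
have cmax : continuous (fun t : R => Num.max 0 t).
  by move=> t; apply: (@continuous_max R R); [exact: cvg_cst|exact: cvg_id].
have cp : continuous p.
  move=> t; apply: cvgD.
    by apply: (@continuous_comp _ _ _ _ w); [exact: cmax|exact: cw].
  by apply: (@continuous_comp _ _ _ _ Num.sqrt);
    [exact: cmax|exact: sqrt_continuous].
have cchi : continuous chi.
  move=> t; apply: cvgB; first exact: cp.
  apply: (@continuous_comp _ _ _ (fun t => - t) p); last exact: cp.
  by apply: cvgN; exact: cvg_id.
have maxp t : 0 <= t -> Num.max 0 t = t by move=> t0; exact/max_idPr.
have maxn t : t <= 0 -> Num.max 0 t = 0 by move=> t0; exact/max_idPl.
have pm s t : s <= t -> p s <= p t.
  move=> st; have m0 : 0 <= Num.max 0 s by rewrite le_max lexx.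
  have mm : Num.max 0 s <= Num.max 0 t.
    by rewrite ge_max !le_max lexx/= st orbT.
  by apply: lerD; [apply: wm; rewrite m0|exact: ler_wsqrtr].
have pp t : 0 <= t -> p t = w t + Num.sqrt t by move=> t0; rewrite /p maxp.
have pn t : t <= 0 -> p t = 0 by move=> t0; rewrite /p maxn// w0 sqrtr0 addr0.
pose g x := clamp (- c) c (chi (x - e)).
exists g; split.
- move=> x; apply: (@continuous_comp _ _ _ (fun x => chi (x - e))).
    apply: (@continuous_comp _ _ _ (fun x => x - e)); last exact: cchi.
    by apply: cvgB; [exact: cvg_id|exact: cvg_cst].
  exact: clamp_continuous.
- move=> x y xy; apply: clamp_mono; rewrite lerD//; first by apply: pm; lra.
  by rewrite lerN2; apply: pm; lra.
- move=> x; have := clamp_in (chi (x - e)) cc.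
  by rewrite in_itv/= ler_norml.
move=> K.
have p0 : p 0 = 0 by exact: pn.
have /cvgrPdist_le/(_ _ c0) := cp 0.
move=> /nbhs_ballP[r /= r0 rp].
have K10 : 0 < K ^+ 2 + 1 by rewrite ltr_wpDl ?sqr_ge0.
(* The first bound keeps [p t <= c], so that the truncation is inactive; the second gives
   [K t <= sqrt t]. *)
exists (Num.min (r / 2) (K ^+ 2 + 1)^-1).
  by rewrite lt_min divr_gt0//= invr_gt0.
move=> t; rewrite le_min => /and3P[t0 tr tK].
have ptc : p t <= c.
  have /rp : ball (0 : R) r t.
    by rewrite -ball_normE/= sub0r normrN ger0_norm//; lra.
  by rewrite /= p0 sub0r normrN; exact: le_trans (ler_norm _).
have pt0 : 0 <= p t by rewrite -p0; exact: pm.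
have Ksq : K * t <= Num.sqrt t.
  have := sqr_sqrtr t0; have := sqrtr_ge0 t; set q := Num.sqrt t => q0 qt.
  have : t * (K ^+ 2 + 1) <= 1 by rewrite -ler_pdivlMr// div1r.
  rewrite -qt => H.
  have Kq : K * q <= 1.
    have := sqr_ge0 (K * q - 1); have := sqr_ge0 q.
    nra.
  nra.
have nt0 : - t <= 0 by lra.
have ge0 : g e = 0.
  by rewrite /g subrr /chi oppr0 p0 subrr clamp_id// in_itv/=; lra.
split.
- have -> : rincr g e t = p t.
    rewrite /rincr ge0 subr0 /g addrAC subrr add0r /chi (pn _ nt0) subr0.
    by rewrite clamp_id// in_itv/=; lra.
  (* The increment of [G] is at least [- w t], which the [w t] inside [p t] cancels; [sqrt t]
     remains and beats [K t]. *)
  have := wG (e + t) e; rewrite addrAC subrr add0r (ger0_norm t0).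
  by rewrite ler_norml pp// /rincr => /andP[]; lra.
- have -> : lincr g e t = p t.
    rewrite /lincr ge0 sub0r /g addrAC subrr add0r /chi opprK (pn _ nt0) sub0r.
    by rewrite clamp_id ?opprK// in_itv/=; lra.
  have := wG e (e - t); rewrite opprB addrCA subrr addr0 (ger0_norm t0).
  by rewrite ler_norml pp// /lincr => /andP[]; lra.
Qed.

(** Geometric domination makes the series converge uniformly. An increment of the sum dominates that
    of each term because the other terms contribute nonnegative increments. *)
Lemma sum_increasing (g : nat -> R -> R) c :
  (forall n, continuous (g n)) -> (forall n, {homo g n : x y / x <= y}) ->
  (forall n x, `|g n x| <= c * 2^-1 ^+ n.+1) ->
  exists S, [/\ continuous S, forall x, `|S x| <= c &
    forall n x y, x <= y -> g n y - g n x <= S y - S x].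
Proof.
move=> cg mg bg.
have half : `|2^-1| < 1 :> R by rewrite ger0_norm//; lra.
pose P m x := series (fun n => g n x) m.
pose S x := limn (series (fun n => g n x)).
have PS x : P m x @[m --> \oo] --> S x.
  apply: normed_cvg; apply: (@series_le_cvg _ _ (geometric (c / 2) 2^-1)).
  - by move=> n /=.
  - move=> n /=; apply: le_trans (normr_ge0 (g n x)) _.
    by rewrite (le_trans (bg n x))// exprS mulrA.
  - by move=> n /=; rewrite (le_trans (bg n x))// exprS mulrA.
  - exact: is_cvg_geometric_series.
(* The right-hand side is the exact sum of the bounds [c / 2^(n+1)] for [N <= n < N + k], so the
   induction telescopes. *)
have PP N k x : `|P (N + k)%N x - P N x| <= c * 2^-1 ^+ N - c * 2^-1 ^+ (N + k).
  elim: k => [|k IH]; first by rewrite addn0 !subrr normr0.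
  rewrite addnS /P seriesSr/= addrAC (le_trans (ler_normD _ _))//.
  have := bg (N + k)%N x; rewrite exprS.
  by move: IH; rewrite /P; set u := 2^-1 ^+ (N + k); lra.
have c0 : 0 <= c.
  by have := le_trans (normr_ge0 _) (bg 0%N 0); rewrite expr1; lra.
have SP N x : `|S x - P N x| <= c * 2^-1 ^+ N.
  apply/ler_addgt0Pr => eps eps0.
  have /cvgrPdist_le/(_ _ eps0)[M _ HM] := PS x.
  have := HM (N + M)%N (leq_addl _ _) => /= SM.
  rewrite -(subrKA (P (N + M)%N x)) (le_trans (ler_normD _ _))//.
  have := PP N M x.
  have : 0 <= c * 2^-1 ^+ (N + M) by rewrite mulr_ge0// exprn_ge0//; lra.
  lra.
have cP N : continuous (P N).
  elim: N => [|N IH].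
    have -> : P 0%N = cst 0 by apply/funext => x; rewrite /P /series/= big_geq.
    exact: cst_continuous.
  have -> : P N.+1 = fun x => P N x + g N x.
    by apply/funext => x; rewrite /P seriesSr.
  by move=> x; apply: cvgD; [exact: IH|exact: cg].
exists S; split.
- move=> x; apply/cvgrPdist_le => eps eps0.
  have e30 : 0 < eps / 3 by lra.
  have /cvgrPdist_le/(_ _ e30)[N _ HN] := cvg_geometric c half.
  have {}HN := HN N (leqnn _).
  have {HN} cN : c * 2^-1 ^+ N <= eps / 3.
    by move: HN => /=; rewrite sub0r normrN; exact: le_trans (ler_norm _).
  have /cvgrPdist_le/(_ _ e30) := cP N x.
  apply: filterS => y xy.
  have := SP N x; have := SP N y; move: xy; rewrite !ler_norml.
  lra.
- by move=> x; have := SP 0%N x; rewrite /P /series/= big_geq// subr0 expr0 mulr1.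
- move=> n x y xy; apply/ler_addgt0Pr => eps eps0.
  have e20 : 0 < eps / 2 by lra.
  have /cvgrPdist_le/(_ _ e20)[M _ HM] := PS x.
  have /cvgrPdist_le/(_ _ e20)[N _ HN] := PS y.
  (* Large enough for both approximations and for the partial sum to contain the [n]-th term. *)
  pose m := (M + (N + n.+1))%N.
  have nm : (n < m)%N by rewrite /m addnA leq_addl.
  have {HM} := HM m (leq_addr _ _); have {HN} : `|S y - P m y| <= eps / 2.
    by apply: HN; rewrite /= /m addnCA leq_addr.
  have : g n y - g n x <= P m y - P m x.
    rewrite /P /series/= !big_mkord -sumrB (bigD1 (Ordinal nm))//= lerDl.
    by apply: sumr_ge0 => k _; rewrite subr_ge0 mg.
  by rewrite !ler_norml; lra.
Qed.

(** Both increments of a nondecreasing [G] are nonnegative, so adding [G] can only enlarge the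
    transforms. *)
Lemma derivate_geD a b F G x c : continuous F -> continuous G ->
  {homo G : x y / x <= y} ->
  derivate_ge a b F x c -> derivate_ge a b (fun y => F y + G y) x c.
Proof.
move=> cF cG mG [rF lF].
have cFG : continuous (fun y => F y + G y).
  by move=> y; apply: cvgD; [exact: cF|exact: cG].
split=> [xb|ax] eps eps0.
- apply: filterS (rF xb _ eps0) => s /le_trans; apply.
  apply: le_lap; [exact: continuous_rincr..|move=> t /andP[t0 _]].
  have : G x <= G (x + t) by apply: mG; rewrite lerDl.
  by rewrite /rincr; lra.
- apply: filterS (lF ax _ eps0) => s /le_trans; apply.
  apply: le_lap; [exact: continuous_lincr..|move=> t /andP[t0 _]].
  have : G (x - t) <= G x by apply: mG; rewrite gerBl.
  by rewrite /lincr; lra.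
Qed.

Lemma lap_ge_linear h d e K eps : continuous h -> 0 < d -> 0 < e -> 0 <= K ->
  (forall t, 0 <= t <= e -> K * t <= h t) -> 0 < eps ->
  \forall s \near +oo_R, K - eps <= lap h d s.
Proof.
move=> ch d0 e0 K0 hK eps0.
have cid : continuous (@id R) by move=> t; exact: cvg_id.
have cK : continuous (fun t => K * id t).
  by move=> t; apply: cvgM; [exact: cvg_cst|exact: cid].
have e20 : 0 < eps / 2 by lra.
have ed : 0 < Num.min d e <= d by rewrite lt_min d0 e0 ge_min lexx.
have H1 : \forall s \near +oo_R, lap (fun t => K * id t) d s <= lap h d s + eps / 2.
  apply: (le_lap_near cK ch ed) => // t; rewrite le_min => /and3P[t0 _ te].
  by apply: hK; rewrite t0.
(* Accuracy [eps / (2 (K + 1))] for the transform of [t] costs at most [eps / 2] after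
   multiplication by [K], also when [K = 0]. *)
have K10 : 0 < 2 * (K + 1) by lra.
have H2 := lap_id_ge_near d0 (divr_gt0 eps0 K10).
apply: filterS (filterI H1 H2) => s [h1 h2].
move: h1; rewrite lapZ// => h1.
have : K * (1 - eps / (2 * (K + 1))) <= K * lap id d s by exact: ler_wpM2l.
rewrite mulrBr mulr1 => h3.
suff : K * (eps / (2 * (K + 1))) <= eps / 2 by lra.
by rewrite mulrA ler_pdivrMr//; nra.
Qed.

Lemma exists_major a b f G (u : nat -> R) M eps : unif_cont G ->
  (forall x, `|G x| <= M) ->
  (forall x, x \in `[a, b] -> (exists n, u n = x) \/ derivate_ge a b G x (f x)) ->
  0 < eps ->
  exists U, [/\ continuous U,
    forall x, x \in `[a, b] -> derivate_ge a b U x (f x) &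
    U b - U a <= G b - G a + eps].
Proof.
move=> uG GM Gf eps0; have cG := unif_cont_continuous uG.
have [w [cw w0 wm wG]] := modulus uG GM.
have e20 : 0 < eps / 2 by lra.
(* These bounds sum to [eps / 2], so [|S| <= eps / 2] and [S] grows by at most [eps] from [a] to
   [b]. *)
have cn n : 0 < eps / 2 * 2^-1 ^+ n.+1 by rewrite mulr_gt0// exprn_gt0//; lra.
have /choice[g gP] n := bump (u n) cw w0 wm wG (cn n).
have [S [cS bS mS]] : exists S, [/\ continuous S, forall x, `|S x| <= eps / 2 &
    forall n x y, x <= y -> g n y - g n x <= S y - S x].
  by apply: sum_increasing => n; case: (gP n).
have hS : {homo S : x y / x <= y}.
  move=> x y xy; rewrite -subr_ge0 (le_trans _ (mS 0%N x y xy))// subr_ge0.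
  by have [_ mg _ _] := gP 0%N; exact: mg.
pose U x := G x + S x.
have cU : continuous U by move=> x; apply: cvgD; [exact: cG|exact: cS].
exists U; split => //; last first.
  by have := bS b; have := bS a; rewrite /U !ler_norml; lra.
move=> x xab; have [[n unx]|Gx] := Gf x xab; last exact: derivate_geD.
(* At an exceptional point any slope is available; [|f x|] is nonnegative, as [lap_ge_linear] asks,
   and at least the arbitrary value [f x]. *)
have [_ _ _ /(_ `|f x|)[d d0 dK]] := gP n; rewrite unx in dK.
split=> [xb|ax] e e0.
- have xb0 : 0 < b - x by rewrite subr_gt0.
  have := @lap_ge_linear (rincr U x) _ _ _ e (continuous_rincr cU) xb0 d0
    (normr_ge0 (f x)).
  have H t : 0 <= t <= d -> `|f x| * t <= rincr U x t.
    move=> td; have [+ _] := dK t td.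
    have xt : x <= x + t by rewrite lerDl; case/andP: td.
    by have := mS n _ _ xt; rewrite /rincr /U; lra.
  move=> /(_ H e0); apply: filterS => s; apply: le_trans.
  by rewrite lerD2r ler_norm.
- have ax0 : 0 < x - a by rewrite subr_gt0.
  have := @lap_ge_linear (lincr U x) _ _ _ e (continuous_lincr cU) ax0 d0
    (normr_ge0 (f x)).
  have H t : 0 <= t <= d -> `|f x| * t <= lincr U x t.
    move=> td; have [_] := dK t td.
    have xt : x - t <= x by rewrite gerBl; case/andP: td.
    by have := mS n _ _ xt; rewrite /lincr /U; lra.
  move=> /(_ H e0); apply: filterS => s; apply: le_trans.
  by rewrite lerD2r ler_norm.
Qed.
End IncreasingPerturbation.

(** * Squeezing the integral between major and minor functions *)

Section MainTheorem.
Variable R : realType.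
Implicit Types (F G U V f g h : R -> R) (a b c x y d e s t eps : R).

Lemma countable_enum (E : set R) : countable E ->
  exists u : nat -> R, forall x, E x -> exists n, u n = x.
Proof.
move=> /countable_injP[i iE].
exists (fun n => xget 0 [set x | E x /\ i x = n]) => x Ex; exists (i x).
case: xgetP => [y _ [Ey yx]|/(_ x)[]//].
by apply: iE => //; rewrite inE.
Qed.

Lemma eq_major a b f F G : {in `[a, b], F =1 G} -> continuous G ->
  major a b f F -> major a b f G.
Proof.
move=> FG cG [_ mF]; split=> [|x xab]; first exact: continuous_subspaceT.
by have [<- _] := eq_LD xab FG; exact: mF.
Qed.

Lemma eq_minor a b f F G : {in `[a, b], F =1 G} -> continuous G ->
  minor a b f F -> minor a b f G.
Proof.
move=> FG cG [_ mF]; split=> [|x xab]; first exact: continuous_subspaceT.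
by have [_ <-] := eq_LD xab FG; exact: mF.
Qed.

Lemma minor_le_major a b f U V : a <= b -> major a b f U -> minor a b f V ->
  V b - V a <= U b - U a.
Proof.
move=> ab mU mV.
have [U' [UU' uU' _]] := continuous_itv_extension ab mU.1.
have [V' [VV' uV' _]] := continuous_itv_extension ab mV.1.
have cU' := unif_cont_continuous uU'; have cV' := unif_cont_continuous uV'.
have aab : a \in `[a, b] by rewrite in_itv/= lexx.
have bab : b \in `[a, b] by rewrite in_itv/= lexx ab.
rewrite !(UU' _ aab, UU' _ bab, VV' _ aab, VV' _ bab).
apply: (derivate_ge_incr_le (f := f)) => //.
  exact/majorP/(eq_major UU').
exact/minorP/(eq_minor VV').
Qed.

Lemma laplace_integral_LD1 a b c F f (E : set R) : a <= c <= b ->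
  {within `[a, b], continuous F} -> countable E ->
  (forall x, x \in `[a, b] -> ~ E x -> LD1 a b F x (f x)) ->
  laplace_integral a c f (F c - F a).
Proof.
move=> /andP[ac cb] cF /countable_enum[u uE] Ff.
have ab := le_trans ac cb.
have [G [FG uG [M GM]]] := continuous_itv_extension ab cF.
have cG := unif_cont_continuous uG.
have GN : unif_cont (\- G).
  move=> e /uG[d d0 dG]; exists d => // x y /dG.
  by rewrite -opprD normrN.
have GNM x : `|(\- G) x| <= M by rewrite normrN.
have sub x : x \in `[a, c] -> x \in `[a, b] by rewrite !in_itv/=; lra.
have LG x : x \in `[a, c] -> (exists n, u n = x) \/ LD1 a b G x (f x).
  move=> /sub xab; have [/uE|nE] := pselect (E x); [by left|right].
  exact: eq_LD1 (Ff x xab nE).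
have mG x : x \in `[a, c] -> (exists n, u n = x) \/ derivate_ge a c G x (f x).
  by move=> /LG[|LGx]; [left|right; exact: LD1_derivate_ge LGx].
have mGN x : x \in `[a, c] ->
    (exists n, u n = x) \/ derivate_ge a c (\- G) x (- f x).
  move=> /LG[|/(LD1N cG) LGx]; [by left|right].
  by apply: LD1_derivate_ge LGx => //; exact: unif_cont_continuous.
have aab : a \in `[a, b] by rewrite in_itv/= lexx.
have cab : c \in `[a, b] by rewrite in_itv/= ac.
rewrite (FG a aab) (FG c cab).
have majors eps : 0 < eps -> exists2 U, major a c f U &
    U c - U a <= G c - G a + eps.
  move=> eps0; have [U [cU mU UG]] := exists_major uG GM mG eps0.
  by exists U => //; exact/majorP.
have minors eps : 0 < eps -> exists2 V, minor a c f V &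
    G c - G a - eps <= V c - V a.
  move=> eps0; have [U [cU mU UG]] := exists_major GN GNM mGN eps0.
  have cNU : continuous (\- U) by move=> z; apply: cvgN; exact: cU.
  exists (\- U); last by move: UG => /=; lra.
  apply/minorP => // x xac; suff -> : \- (\- U) = U by exact: mU.
  by apply/funext => z /=; rewrite opprK.
(* Each extremum is reached up to [eps] by the functions just built; in the other direction, every
   minor or major function is compared with a nearly optimal one of the opposite kind. *)
split; apply/eqP; rewrite eq_le; apply/andP; split.
- apply: ge_ereal_sup => _ [V mV <-]; apply/lee_addgt0Pr => eps eps0.
  have [U mU UG] := majors _ eps0; rewrite -EFinD lee_fin.
  exact: le_trans (minor_le_major ac mU mV) UG.
- apply/lee_addgt0Pr => eps eps0; have [V mV VG] := minors _ eps0.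
  rewrite -leeBlDr// -EFinB; apply: ereal_sup_ge.
  by exists (V c - V a)%:E; [exists V|rewrite lee_fin].
- apply/lee_addgt0Pr => eps eps0; have [U mU UG] := majors _ eps0.
  rewrite -EFinD; apply: (@le_trans _ _ (U c - U a)%:E); last by rewrite lee_fin.
  by apply: ereal_inf_lbound; exists U.
- apply: le_ereal_inf_tmp => _ [U mU <-]; rewrite -[leRHS]oppeK leeNr.
  apply/lee_addgt0Pr => eps eps0; have [V mV VG] := minors _ eps0.
  rewrite -!EFinN -EFinD lee_fin.
  by have := minor_le_major ac mU mV; lra.
Qed.
End MainTheorem.

Theorem theorem5p3 (R : realType) (a b : R) (F : R -> R) (E : set R) (f : R -> R) :
  a < b ->
  {within `[a, b], continuous F} ->
  countable E ->
  (forall x, x \in `[a, b] -> ~ E x -> exists L : R, LD1 a b F x L) ->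
  (forall x, x \in `[a, b] -> ~ E x -> LD1 a b F x (f x)) ->
  laplace_integrable a b f /\
  (forall x, x \in `[a, b] -> laplace_integral a x f (F x - F a)).
Proof.
move=> ab cF cE _ Ff.
have H x : x \in `[a, b] -> laplace_integral a x f (F x - F a).
  by rewrite in_itv/= => axb; exact: (laplace_integral_LD1 axb cF cE Ff).
by split=> //; exists (F b - F a); apply: H; rewrite in_itv/= ltW//= lexx.
Qed.
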